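(* Let $\varphi:\mathbb{R}_+\to\mathbb{R}_+$ be a differentiable and strictly convex admissible function such that $\varphi'(0)=0$. Let $X$ be a Banach space, let $f:X\to\mathbb{R}\cup\{+\infty\}$ be a proper lower semicontinuous function, and let $\bar x\in{\rm dom}(f)$. Then $f$ has $\varphi$-SLWP at $\bar x$ if and only if $f$ has $\varphi$-SWLWP at $\bar x$.
   Context: $\mathbb{R}_+=[0,+\infty)$; $B_X(x,r)$ and $B_X[x,r]$ are the open and closed balls; ${\rm dom}(f)=\{x: f(x)<+\infty\}$; $X^*$ is the dual of $X$, and $f_{u^*}(x):=f(x)-\langle u^*,x\rangle$. $d(x,A)=\inf_{a\in A}\|x-a\|$, with $d(x,\emptyset)=+\infty$ and $\varphi(+\infty)=\lim_{t\to+\infty}\varphi(t)=+\infty$. Admissible function: a nondecreasing $\varphi:\mathbb{R}_+\to\mathbb{R}_+$ with $\varphi(0)=0$ such that $\varphi(t)\to0$ implies $t\to0$. The derivative at $0$ is the right derivative. $\varphi$-SLWP (stable local well-posedness) of $f$ at $\bar x\in{\rm dom}(f)$: there exist $\delta,r,\tau,\kappa\in(0,+\infty)$ such that for every $u^*\in B_{X^*}(0,\delta)$ there is $x_{u^*}\in B_X[\bar x,r]$, with $x_0=\bar x$, satisfying $\varphi(\kappa\|x-x_{u^*}\|)\le\tau(f_{u^*}(x)-f_{u^*}(x_{u^*}))$ for all $x\in B_X[\bar x,r]$. $\varphi$-SWLWP (stable weak local well-posedness) of $f$ at $\bar x\in{\rm dom}(f)$: there exist $r,\gamma,\delta,\tau,\kappa\in(0,+\infty)$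 such that $\min_{x\in B_X[\bar x,r]}f(x)=f(\bar x)$ and $$\varphi\Big(\tau\, d\big(x,\mathop{\arg\min}_{z\in B_X[\bar x,r]}f_{u^*}(z)\big)\Big)\le\kappa\Big(f_{u^*}(x)-\min_{z\in B_X[\bar x,r]}f_{u^*}(z)\Big)$$ for all $(x,u^* )\in B_X(\bar x,\gamma)\times B_{X^*}(0,\delta)$ (the last $\min$ is read as an infimum if it is not attained). *)

(* Defs.v *)
From HB Require Import structures.
From mathcomp Require Import all_boot all_order all_algebra.
From mathcomp Require Import all_classical all_reals all_analysis.

Set Implicit Arguments.
Unset Strict Implicit.
Unset Printing Implicit Defensive.

Import Order.TTheory GRing.Theory Num.Theory.
Import numFieldNormedType.Exports.

Local Open Scope classical_set_scope.
Local Open Scope ring_scope.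

Section GaugeFunctions.
Variable R : realType.
Implicit Type phi : R -> R.

(* A function from [0, +oo[ to itself is represented by phi : R -> R; every
   condition below, and every use of phi, only involves its values on
   [0, +oo[. *)
Definition admissible phi :=
  [/\ forall t, 0 <= t -> 0 <= phi t,
      forall s t, 0 <= s -> s <= t -> phi s <= phi t,
      phi 0 = 0
    & forall t : nat -> R, (forall n, 0 <= t n) ->
        phi (t n) @[n --> \oo] --> (0 : R) -> t n @[n --> \oo] --> (0 : R)].

Definition strictly_convex_nneg phi :=
  forall s t l, 0 <= s -> 0 <= t -> s != t -> 0 < l -> l < 1 ->
    phi (l * s + (1 - l) * t) < l * phi s + (1 - l) * phi t.

Definition has_right_derivative0 phi (d : R) :=
  h^-1 * (phi h - phi 0) @[h --> (0 : R)^'+] --> d.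

Definition differentiable_nneg phi :=
  (forall t, 0 < t -> derivable phi t 1) /\
  exists d, has_right_derivative0 phi d.

(* phi(+oo) = lim_{t -> +oo} phi(t) = +oo; the value at -oo is irrelevant. *)
Definition extend_gauge phi (t : \bar R) : \bar R :=
  match t with
  | r%:E => (phi r)%:E
  | +oo => +oo
  | -oo => 0
  end%E.

End GaugeFunctions.

Section WellPosedness.
Variables (R : realType) (X : completeNormedModType R).

Record dual_space := Dual {
  dual_val :> {linear X -> R^o};
  dual_continuous : continuous dual_val }.

Definition dual_norm (u : dual_space) : R :=
  sup [set `|u x| | x in [set x : X | `|x| <= 1]].

Implicit Types (f g : X -> \bar R) (phi : R -> R) (A : set X).

Definition dom f : set X := [set x | f x < +oo]%E.

Definition proper_fun f := (forall x, f x != -oo%E) /\ dom f !=set0.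

Definition tilt f (u : dual_space) : X -> \bar R := fun x => (f x - (u x)%:E)%E.

Definition dist_to (x : X) A : \bar R := ereal_inf [set `|x - a|%:E | a in A].

Definition argmin A g : set X :=
  [set z | A z /\ forall w, A w -> (g z <= g w)%E].

Definition is_min A g (m : \bar R) :=
  (exists2 z, A z & g z = m) /\ forall w, A w -> (m <= g w)%E.

Definition inf_over A g : \bar R := ereal_inf [set g z | z in A].

(* In \bar R one has (+oo) - (+oo) = (-oo); so, phi being nonnegative, the
   inequality at x = xbar, where f is finite, forces f xu < +oo. *)
Definition SLWP phi f (xbar : X) :=
  exists delta r tau kappa : R,
    [/\ 0 < delta, 0 < r, 0 < tau & 0 < kappa] /\
    forall u : dual_space, dual_norm u < delta ->
      exists xu : X,
        [/\ closed_ball_ Num.norm xbar r xu,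
            (forall x, u x = 0) -> xu = xbar
          & forall x, closed_ball_ Num.norm xbar r x ->
              ((phi (kappa * `|x - xu|))%:E
                 <= tau%:E * (tilt f u x - tilt f u xu))%E].

Definition SWLWP phi f (xbar : X) :=
  exists r gamma delta tau kappa : R,
    [/\ 0 < r, 0 < gamma, 0 < delta, 0 < tau & 0 < kappa] /\
    (let B := closed_ball_ Num.norm xbar r in
     is_min B f (f xbar) /\
     forall (x : X) (u : dual_space), ball xbar gamma x -> dual_norm u < delta ->
       (extend_gauge phi (tau%:E * dist_to x (argmin B (tilt f u)))
          <= kappa%:E * (tilt f u x - inf_over B (tilt f u)))%E).

End WellPosedness.

(* Main.v *)
Require Import Defs.
From HB Require Import structures.
From mathcomp Require Import all_boot all_order all_algebra.
From mathcomp Require Import all_classical all_reals all_analysis.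
From mathcomp Require Import ring lra.

Import Order.TTheory GRing.Theory Num.Theory.
Import numFieldNormedType.Exports.

Local Open Scope classical_set_scope.
Local Open Scope ring_scope.

(* Write S(u) for the set of minimizers of f_u over the ball B[xbar, r].

   Under SLWP the point x_u is the only element of S(u), because phi vanishes
   only at 0, and the SLWP inequality is then the SWLWP one.

   Conversely, for x in S(u) near xbar and y in S(v), minimality of x gives
   f_v(x) - f_v(y) <= |v - u| |x - y|, so SWLWP yields
   phi(tau d) <= kappa |v - u| d with d = d(x, S(v)). As phi(t) / t is positive
   and nondecreasing, d is small when |v - u| is.  If S(u) contained two points
   x0 and x1 with x0 near xbar, tilting u by a small functional that norms
   x1 - x0 (Hahn-Banach) would keep all minimizers at distance at least
   |x1 - x0| from x0, a contradiction; hence S(u) is a single point, close to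
   xbar = S(0), and SWLWP becomes SLWP on a smaller ball. *)

(** * Sublinear functions and their linear minorants (Hahn-Banach) *)

Definition sublinear {R : realType} {X : lmodType R} (q : X -> R) :=
  (forall x y, q (x + y) <= q x + q y) /\
  (forall c x, 0 < c -> q (c *: x) <= c * q x).

Section Sublinear.
Variables (R : realType) (X : lmodType R).
Implicit Types (q : X -> R) (x y : X).

Lemma sublinear0 q : sublinear q -> 0 <= q 0.
Proof. by case=> qD _; have := qD 0 0; rewrite addr0; lra. Qed.

Lemma sublinear_ge_opp q x : sublinear q -> - q (- x) <= q x.
Proof.
move=> sq; have := sublinear0 q sq; case: sq => qD _.
by have := qD x (- x); rewrite subrr; lra.
Qed.

(** The missing inequality comes from scaling [c *: x] back by [c^-1]. *)
Lemma sublinearZ q c x : sublinear q -> 0 < c -> q (c *: x) = c * q x.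
Proof.
move=> [_ qZ] c0; apply/eqP; rewrite eq_le qZ //= mulrC -ler_pdivlMr //.
rewrite [leRHS]mulrC -{1}[x](scalerK (lt0r_neq0 c0)).
by apply: qZ; rewrite invr_gt0.
Qed.

(* Stated for a family that is only jointly sublinear, to cover both the
   infimum of a chain and the shifts of one sublinear function. *)
Lemma sublinear_inf (I : Type) (D : set I) (F : I -> X -> R) (m : X -> R) :
  D !=set0 ->
  (forall i x, D i -> m x <= F i x) ->
  (forall i j x y, D i -> D j ->
     exists2 k, D k & F k (x + y) <= F i x + F j y) ->
  (forall i c x, D i -> 0 < c -> exists2 k, D k & F k (c *: x) <= c * F i x) ->
  sublinear (fun x => inf [set F i x | i in D]).
Proof.
move=> [i0 Di0] mF FD FZ.
have infF i x : D i -> inf [set F i x | i in D] <= F i x.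
  move=> Di; apply: ge_inf; last by exists i.
  by exists (m x) => _ [j Dj <-]; exact: mF.
have le_infF z x : (forall i, D i -> z <= F i x) ->
    z <= inf [set F i x | i in D].
  move=> zF; apply: lb_le_inf; first by exists (F i0 x), i0.
  by move=> _ [j Dj <-]; exact: zF.
split=> [x y|c x c0].
  rewrite -lerBlDr; apply: (le_infF) => i Di.
  rewrite lerBlDr -lerBlDl; apply: (le_infF) => j Dj; rewrite lerBlDl.
  by have [k Dk /(le_trans _)] := FD _ _ x y Di Dj; apply; exact: infF.
rewrite mulrC -ler_pdivrMr //; apply: (le_infF) => i Di.
rewrite ler_pdivrMr // mulrC.
by have [k Dk /(le_trans _)] := FZ _ c x Di c0; apply; exact: infF.
Qed.

(* [p x = inf_(t >= 0) (q (x + t a) - t q a)]; it forces a minimal [q] to be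
   odd, and turns the norm into a sublinear function whose linear minorants
   norm [a]. *)
Lemma sublinear_shift q (a : X) : sublinear q ->
  exists2 p, sublinear p & (forall x, p x <= q x) /\ p (- a) <= - q a.
Proof.
move=> sq; have [qD _] := sq.
have q00 : q 0 <= 0.
  by have := sublinearZ q 2 0 sq (ltr0Sn _ 1); rewrite scaler0; lra.
pose D : set R := [set t | 0 <= t].
pose F (t : R) x := q (x + t *: a) - t * q a.
(* Subadditivity at [x + t *: a] and [- x] gives a bound independent of [t], so [inf] is a true
   infimum. *)
have mF t x : D t -> - q (- x) <= F t x.
  rewrite /D /F /= le_eqVlt => /orP[/eqP<-|t0].
    by rewrite scale0r addr0 mul0r subr0; exact: sublinear_ge_opp.
  rewrite -(sublinearZ _ _ _ sq t0).
  have := qD (x + t *: a) (- x); rewrite addrAC subrr add0r; lra.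
have infF t x : D t -> inf [set F t x | t in D] <= F t x.
  move=> Dt; apply: ge_inf; last by exists t.
  by exists (- q (- x)) => _ [j Dj <-]; exact: mF.
exists (fun x => inf [set F t x | t in D]).
  apply: (@sublinear_inf _ _ _ (fun x => - q (- x))) => //.
  - by exists 0; rewrite /D /=.
  - move=> s t x y s0 t0; exists (s + t); first exact: addr_ge0.
    have := qD (x + s *: a) (y + t *: a).
    rewrite /F scalerDl addrACA mulrDl; lra.
  - move=> t c x t0 c0; exists (c * t); first exact: mulr_ge0 (ltW c0) t0.
    rewrite /F -[in leLHS]scalerA -scalerDr (sublinearZ _ _ _ sq c0) mulrBr.
    by rewrite mulrA; lra.
(* The parameters [t = 0] and [t = 1] give the two bounds. *)
split=> [x|].
  have := infF 0 x (lexx _); rewrite {2}/F scale0r addr0 mul0r subr0; exact.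
have := infF 1 (- a) ler01; rewrite {2}/F scale1r addNr mul1r; lra.
Qed.

(** Zorn's lemma for the reversed pointwise order: a chain is bounded by its pointwise infimum,
    which is finite because every sublinear function below [p] is at least [- p (- x)] at [x]. *)
Lemma sublinear_minimal p : sublinear p ->
  exists2 q, sublinear q /\ (forall x, q x <= p x) &
    forall g, sublinear g -> (forall x, g x <= q x) -> g = q.
Proof.
move=> sp.
pose below q := sublinear q /\ forall x, q x <= p x.
pose T := {q | below q}.
have [||||[q [sq qp]] qmin] :=
  @Zorn T (fun s t => `[< forall x, sval t x <= sval s x >]).
- by move=> t; apply/asboolP.
- move=> r s t /asboolP rs /asboolP st; apply/asboolP => x.
  exact: le_trans (st x) (rs x).
- move=> [s Hs] [t Ht] /asboolP/= st /asboolP/= ts; apply: eq_exist.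
  by apply/funext => x; apply/eqP; rewrite eq_le ts st.
(* The infimum requires a nonempty chain; [p] itself bounds the empty one. *)
- move=> A Atot; have [->|/set0P[[p0 [sp0 p0p]] Ap0]] := eqVneq A set0.
    by exists (exist below p (conj sp (fun x => lexx (p x)))) => s.
  pose m x := - p (- x).
  have mA (s : T) x : A s -> m x <= sval s x.
    case: s => /= s [ss sps] _.
    by apply: le_trans (sublinear_ge_opp s x ss); rewrite lerN2.
  have infA (s : T) x : A s -> inf [set sval t x | t in A] <= sval s x.
    move=> As; apply: ge_inf; last by exists s.
    by exists (m x) => _ [t At <-]; exact: mA.
  have sg : sublinear (fun x => inf [set sval t x | t in A]).
    apply: (@sublinear_inf T A (fun t => sval t) m) => //.
    - by exists (exist below p0 (conj sp0 p0p)).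
    - move=> s t x y As At; have [/asboolP ts|/asboolP st] := Atot s t As At.
        exists t => //; have [[tD _] _] := svalP t.
        exact: le_trans (tD x y) (lerD (ts x) (lexx _)).
      exists s => //; have [[sD _] _] := svalP s.
      exact: le_trans (sD x y) (lerD (lexx _) (st y)).
    - move=> s c x As c0; exists s => //.
      by have [[_ sZ] _] := svalP s; exact: sZ.
  have gp x : inf [set sval t x | t in A] <= p x.
    exact: le_trans (infA _ x Ap0) (p0p x).
  exists (exist below _ (conj sg gp)) => s As; apply/asboolP => x /=.
  exact: infA.
exists q => // g sg gq.
have gp x : g x <= p x by exact: le_trans (gq x) (qp x).
suff : exist below g (conj sg gp) = exist below q (conj sq qp)
  by move=> /(congr1 sval).
by apply: qmin; apply/asboolP.
Qed.

(** A minimal [q] below [p] is linear. Minimality identifies [q] with its shift along [x], so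
    [q (- x) <= - q x] and [q] is odd; oddness then turns subadditivity into additivity. *)
Lemma sublinear_dominates_linear p : sublinear p ->
  exists2 w : X -> R, (forall x, w x <= p x) &
    forall c x y, w (c *: x + y) = c * w x + w y.
Proof.
move=> /sublinear_minimal[q [sq qp] qmin]; exists q => //.
have [qD qZ] := sq.
have qN x : q (- x) = - q x.
  have [g sg [gq ga]] := sublinear_shift q x sq.
  have := sublinear_ge_opp q x sq; move: ga; rewrite (qmin _ sg gq); lra.
have q0 : q 0 = 0 by have := qN 0; rewrite oppr0; lra.
have qDE x y : q (x + y) = q x + q y.
  by have := qD (- x) (- y); have := qD x y; rewrite -opprD !qN; lra.
move=> c x y; rewrite qDE; congr (_ + _).
have [c0|c0|<-] := ltgtP 0 c.
- exact: sublinearZ.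
- by rewrite -[c]opprK scaleNr qN sublinearZ ?oppr_gt0 // !mulNr.
- by rewrite scale0r mul0r.
Qed.

End Sublinear.

(** * Dual norm, norming functionals and perturbations of functionals *)

Section DualSpace.
Variables (R : realType) (X : completeNormedModType R).
Implicit Types (u v w : dual_space X) (x e : X).

Lemma dual_spaceP (g : X -> R) (M : R) :
  (forall c x y, g (c *: x + y) = c * g x + g y) ->
  (forall x, `|g x| <= M * `|x|) -> exists w : dual_space X, w =1 g.
Proof.
move=> glin gM.
pose gL := HB.pack_for {linear X -> R^o} (g : X -> R^o)
  (@GRing.isLinear.Build R X R^o _ g glin).
suff gC : continuous gL by exists (Dual gC).
apply: (@bounded_linear_continuous R X R^o gL).
apply/(@linear_boundedP R X R^o gL).
near=> r => x; apply: le_trans (gM x) _; apply: ler_wpM2r => //.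
Unshelve. all: by end_near.
Qed.

Lemma dualB u x y : u (x - y) = u x - u y :> R.
Proof. exact: linearB. Qed.

Lemma dual_norm_le u (M : R) :
  (forall x, `|x| <= 1 -> `|u x| <= M) -> dual_norm u <= M.
Proof.
move=> uM; apply: ge_sup; last by move=> _ [x x1 <-]; exact: uM.
by exists `|u 0|, 0 => //=; rewrite normr0.
Qed.

Lemma dual_norm_ub u x : `|x| <= 1 -> `|u x| <= dual_norm u.
Proof.
move=> x1; apply: ub_le_sup; last by exists x.
(* Continuity bounds the set whose [sup] defines [dual_norm u]; only then is [sup] an upper
   bound. *)
have /(@linear_boundedP R X R^o u)/pinfty_ex_gt0[M M0 uM] :
    bounded_near (u : X -> R^o) (nbhs (0 : X)).
  by apply/(@linear_bounded_continuous R X R^o u); exact: dual_continuous.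
exists M => _ [y /= y1 <-]; apply: le_trans (uM y) _.
exact: ler_piMr (ltW M0) y1.
Qed.

Lemma dual_norm_bound u x : `|u x| <= dual_norm u * `|x|.
Proof.
have [->|x0] := eqVneq x 0; first by rewrite linear0 !normr0 mulr0.
have nx0 : 0 < `|x| by rewrite normr_gt0.
rewrite -ler_pdivrMr //.
have -> : `|u x| / `|x| = `|u (`|x|^-1 *: x)|.
  by rewrite linearZ /= normrM normfV normr_id mulrC.
by apply: dual_norm_ub; rewrite normrZ normfV normr_id mulVf ?gt_eqF.
Qed.

Lemma dual_zero : exists u : dual_space X, forall x, u x = 0.
Proof.
apply: (@dual_spaceP (fun=> 0) 0) => *; first by rewrite mulr0 addr0.
by rewrite normr0 mul0r.
Qed.

(** A linear minorant of the norm shifted along [e] lies below the norm and is at most [- |e|] at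
    [- e]. *)
Lemma dual_norming e : exists2 w : dual_space X,
  (forall x, `|w x| <= `|x|) & `|e| <= w e.
Proof.
have sn : sublinear (fun x => `|x|).
  split; first exact: ler_normD.
  by move=> c x c0; rewrite normrZ gtr0_norm.
have [p sp [pn pe]] := sublinear_shift _ _ _ e sn.
have [g gp glin] := sublinear_dominates_linear _ _ p sp.
have gn x : g x <= `|x| by exact: le_trans (gp x) (pn x).
have g0 : g 0 = 0 by have := glin 1 0 0; rewrite scale1r addr0; lra.
have gN x : g (- x) = - g x.
  by have := glin (-1) x 0; rewrite scaleN1r addr0 g0; lra.
have gabs x : `|g x| <= `|x|.
  by rewrite ler_norml gn andbT lerNl -gN -normrN.
have [|w wg] := @dual_spaceP g 1 glin; first by move=> x; rewrite mul1r.
exists w => [x|]; rewrite wg //.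
have := gp (- e); rewrite gN; lra.
Qed.

Lemma dual_perturb u w (c : R) :
  exists v : dual_space X, forall x, v x = u x + c * w x.
Proof.
have [a x y|x|v vE] := @dual_spaceP (fun x => u x + c * w x)
  (dual_norm u + `|c| * dual_norm w); last by exists v.
  rewrite !linearP /= /GRing.scale /=; ring.
rewrite mulrDl -mulrA; apply: le_trans (ler_normD _ _) _.
rewrite normrM; apply: lerD; first exact: dual_norm_bound.
by apply: ler_wpM2l => //; exact: dual_norm_bound.
Qed.

End DualSpace.

(** * Positivity and slopes of the gauge *)

Section Gauge.
Variables (R : realType) (phi : R -> R).
Hypotheses (phi_adm : admissible phi) (phi_convex : strictly_convex_nneg phi).

(** Strict convexity at the midpoint of 0 and [t] puts half of [phi t] strictly above a value that
    is nonnegative. *)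
Lemma gauge_gt0 t : 0 < t -> 0 < phi t.
Proof.
move=> t0; have [phi0 _ phi00 _] := phi_adm.
have := phi_convex 0 t 2^-1 (lexx _) (ltW t0).
rewrite eq_sym gt_eqF // => /(_ isT); rewrite mulr0 add0r phi00 mulr0 add0r.
have /phi0 : 0 <= (1 - 2^-1) * t by lra.
by rewrite invr_gt0 ltr0Sn invf_lt1 ?ltr1n ?ltr0Sn // => ? /(_ isT isT); lra.
Qed.

(** Monotonicity of [phi t / t], cleared of denominators: [s] is the convex combination of [t] and 0
    with weight [s / t], and [phi 0 = 0]. *)
Lemma gauge_slope s t : 0 < s -> s <= t -> phi s * t <= s * phi t.
Proof.
move=> s0; rewrite le_eqVlt => /orP[/eqP->|st]; first by rewrite mulrC.
have t0 : 0 < t by exact: lt_trans st.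
have [_ _ phi00 _] := phi_adm.
have := phi_convex t 0 (s / t) (ltW t0) (lexx _).
rewrite gt_eqF // divr_gt0 // ltr_pdivrMr // mul1r st => /(_ isT isT isT).
rewrite phi00 !mulr0 !addr0 divfK ?gt_eqF // => /ltW.
by rewrite mulrAC ler_pdivlMr.
Qed.

End Gauge.

(** * Minimizers of tilted functions and the two implications *)

Section Tilt.
Variables (R : realType) (X : completeNormedModType R) (f : X -> \bar R).
Implicit Types (u v : dual_space X) (x y : X) (B : set X).

Lemma argmin_tilt_fin B xb u x : proper_fun f -> B xb -> dom f xb ->
  argmin B (tilt f u) x -> exists a : R, f x = a%:E.
Proof.
move=> [fNy _] Bxb; rewrite /dom /= => fxb [Bx /(_ _ Bxb)]; rewrite /tilt.
move: (fNy x) (fNy xb) fxb; case: (f x) => [a| |] //; first by exists a.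
by case: (f xb).
Qed.

Lemma inf_over_argmin B (g : X -> \bar R) y :
  argmin B g y -> inf_over B g = g y.
Proof.
move=> [By gy]; apply/le_anti/andP; split.
  by apply: ereal_inf_lbound; exists y.
by apply: le_ereal_inf_tmp => _ [z Bz <-]; exact: gy.
Qed.

Lemma dist_to1 x y : dist_to x [set y] = `|x - y|%:E.
Proof. by rewrite /dist_to image_set1 ereal_inf1. Qed.

Variable phi : R -> R.
Hypotheses (phi_adm : admissible phi) (phi_convex : strictly_convex_nneg phi).
Hypotheses (f_proper : proper_fun f).
Variables (xbar : X) (xbar_dom : dom f xbar).

Lemma SLWP_SWLWP : SLWP phi f xbar -> SWLWP phi f xbar.
Proof.
move=> [delta [r [tau [kappa [[d0 r0 t0 k0] H]]]]].
(* The two definitions exchange the roles of [tau] and [kappa]. *)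
exists r, r, delta, kappa, tau; split; first by split.
move=> B; have Bxbar : B xbar by rewrite /B /closed_ball_ /= subrr normr0 ltW.
have [phi0 _ phi00 _] := phi_adm.
have min u xu : (forall x, B x -> ((phi (kappa * `|x - xu|))%:E
     <= tau%:E * (tilt f u x - tilt f u xu))%E) -> B xu ->
    (exists a : R, f xu = a%:E) /\ argmin B (tilt f u) = [set xu].
  move=> Hu Bxu; have [fNy _] := f_proper.
  have [a fxu] : exists a : R, f xu = a%:E.
    (* If [f xu] were [+oo], the inequality at [xbar] would bound a real number by [-oo]. *)
    have := Hu _ Bxbar; move: (fNy xu) (fNy xbar) xbar_dom.
    rewrite /tilt /dom /=; case: (f xu) => [a| |] //; first by exists a.
    case: (f xbar) => [b| |] //= _ _ _.
    by rewrite gt0_muleNy ?lte_fin // leeNy_eq.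
  split; first by exists a.
  have Hu' x : B x ->
      (tilt f u xu + (phi (kappa * `|x - xu|) / tau)%:E <= tilt f u x)%E.
    move=> Bx; have := Hu _ Bx; rewrite /tilt fxu; move: (fNy x).
    case: (f x) => [b| |] // _; last by rewrite leey.
    rewrite -!EFinB -EFinM -EFinD !lee_fin [leRHS]mulrC -ler_pdivrMr //; lra.
  apply/seteqP; split=> [x [Bx /(_ _ Bxu) xmin]|_ ->].
    have := le_trans (Hu' _ Bx) xmin.
    rewrite /tilt fxu -EFinB -EFinD lee_fin gerDl => le0.
    apply/eqP; rewrite -subr_eq0 -normr_eq0; apply/negPn/negP => ne.
    have : 0 < `|x - xu| by rewrite lt_neqAle eq_sym ne /=.
    move=> /(mulr_gt0 k0)/(gauge_gt0 _ _ phi_adm phi_convex).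
    by move=> /(fun h => divr_gt0 h t0); rewrite ltNge le0.
  split=> // x Bx; apply: le_trans (Hu' _ Bx); apply: leeDl.
  by rewrite lee_fin divr_ge0 ?(ltW t0) // phi0 // mulr_ge0 // ltW.
split.
  (* The zero functional, for which the chosen point is [xbar], shows that [xbar] minimizes [f] over
     [B]. *)
  have [z z0] := dual_zero _ X.
  have [|xz [Bxz /(_ z0) xzE Hz]] := H z.
    apply: le_lt_trans d0; apply: dual_norm_le => x _.
    by rewrite z0 normr0.
  subst xz; have [_ /seteqP[_ /(_ _ erefl)[_ zmin]]] := min _ _ Hz Bxz.
  split; first by exists xbar.
  by move=> w Bw; have := zmin _ Bw; rewrite /tilt !z0 !sube0.
move=> x u xr ud; have [xu [Bxu _ Hu]] := H u ud.
have [[a fxu] argE] := min _ _ Hu Bxu.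
rewrite argE dist_to1 -EFinM /= (inf_over_argmin _ _ xu); last by rewrite argE.
apply: Hu; move: xr; rewrite /closed_ball_ -ball_normE /=; exact: ltW.
Qed.

(** * Stability and uniqueness of minimizers under the weak inequality *)

Section WeakWellPosed.
Variables (r gamma delta tau kappa : R).
Let B := closed_ball_ Num.norm xbar r.
Hypotheses (r0 : 0 < r) (g0 : 0 < gamma) (t0 : 0 < tau) (k0 : 0 < kappa).
Hypothesis weak : forall x u, ball xbar gamma x -> dual_norm u < delta ->
  (extend_gauge phi (tau%:E * dist_to x (argmin B (tilt f u)))
     <= kappa%:E * (tilt f u x - inf_over B (tilt f u)))%E.

Let Bxbar : B xbar.
Proof. by rewrite /B /closed_ball_ /= subrr normr0 ltW. Qed.

(** The bound [eps] is uniform in [u], [v] and [x]. The lemma serves twice: from the zero functional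
    it locates minimizers near [xbar], and with [eta] the distance between two minimizers it yields
    uniqueness. *)
Lemma argmin_tilt_stable (eta : R) : 0 < eta -> exists2 eps : R, 0 < eps &
  forall u v x, dual_norm v < delta -> ball xbar gamma x ->
    argmin B (tilt f u) x -> (forall z, `|v z - u z| <= eps * `|z|) ->
    exists2 y, argmin B (tilt f v) y & `|x - y| < eta.
Proof.
move=> eta0; have pe0 : 0 < phi (tau * eta).
  by apply: gauge_gt0 => //; exact: mulr_gt0.
(* Chosen so that [kappa * eps] is half the slope [phi (tau * eta) / eta]; by [gauge_slope], no
   [d >= eta] can then satisfy [phi (tau * d) <= kappa * eps * d]. *)
pose eps := phi (tau * eta) / (2 * eta * kappa).
have eps0 : 0 < eps by rewrite divr_gt0 // !mulr_gt0.
exists eps => // u v x vd xg xu vu.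
have [a fx] := argmin_tilt_fin _ _ _ _ f_proper Bxbar xbar_dom xu.
have [Bx xmin] := xu.
have fvlb z : B z -> ((a - v x - eps * `|x - z|)%:E <= tilt f v z)%E.
  move=> /xmin; have [/(_ z) + _] := f_proper; rewrite /tilt fx.
  case: (f z) => [b _|_ _|//]; last by rewrite leey.
  rewrite -!EFinB !lee_fin => ab.
  have := vu (x - z); rewrite !dualB => /ler_normlP[+ _]; lra.
have := weak _ _ xg vd.
(* With a finite infimum the right-hand side of [weak] is finite, which excludes an infinite
   distance, hence an empty set of minimizers. The lower bound uses that points of [B] are at most
   [2 * r] apart. *)
have [infv Einf] : exists m : R, inf_over B (tilt f v) = m%:E.
  have le1 : (inf_over B (tilt f v) <= tilt f v x)%E.
    by apply: ereal_inf_lbound; exists x.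
  have le2 : ((a - v x - eps * (2 * r))%:E <= inf_over B (tilt f v))%E.
    apply: le_ereal_inf_tmp => _ [z Bz <-]; apply: le_trans (fvlb _ Bz).
    rewrite lee_fin lerB // ler_pM2l //.
    rewrite (_ : x - z = (xbar - z) - (xbar - x)); last first.
      by rewrite opprB [RHS]addrC subrKA.
    apply: le_trans (ler_normB _ _) _.
    move: Bz Bx; rewrite /B /closed_ball_ /=; lra.
  move: le1 le2; rewrite /tilt fx -EFinB.
  by case: (inf_over _ _) => [m| |] //; exists m.
rewrite {2}/tilt Einf fx -!EFinB -EFinM.
have dist0 : (0 <= dist_to x (argmin B (tilt f v)))%E.
  by apply: le_ereal_inf_tmp => _ [z _ <-]; rewrite lee_fin.
case Ed : (dist_to x (argmin B (tilt f v))) dist0 => [d| |] //; last first.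
  by rewrite gt0_muley ?lte_fin.
rewrite -EFinM /= !lee_fin => d0 pd.
have dle y : argmin B (tilt f v) y -> d <= `|x - y|.
  by move=> yv; rewrite -lee_fin -Ed; apply: ereal_inf_lbound; exists y.
have led (z : R) : (forall y, argmin B (tilt f v) y -> z <= `|x - y|) -> z <= d.
  move=> H; rewrite -lee_fin -Ed; apply: le_ereal_inf_tmp => _ [y yv <-].
  by rewrite lee_fin H.
have pdle y : argmin B (tilt f v) y -> phi (tau * d) <= kappa * eps * `|x - y|.
  move=> yv; apply: le_trans pd _; rewrite -mulrA ler_pM2l //.
  have [By _] := yv; have := fvlb _ By.
  rewrite -(inf_over_argmin _ _ _ yv) Einf lee_fin; lra.
apply: contrapT => noy.
have etad : eta <= d.
  apply: (led) => y yv; rewrite leNgt; apply/negP => lt.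
  by apply: noy; exists y.
have dpos : 0 < d by exact: lt_le_trans etad.
have ke0 : 0 < kappa * eps by exact: mulr_gt0.
(* The distance [d] need not be attained, so the estimate [pdle] is passed to the infimum over
   [y]. *)
have : phi (tau * d) <= kappa * eps * d.
  rewrite [leRHS]mulrC -ler_pdivrMr //; apply: (led) => y yv.
  by rewrite ler_pdivrMr // [leRHS]mulrC pdle.
have := gauge_slope _ _ phi_adm phi_convex (tau * eta) (tau * d)
  (mulr_gt0 t0 eta0).
rewrite ler_pM2l // => /(_ etad).
rewrite mulrCA -[leRHS]mulrA ler_pM2l // => slope pled.
have : phi (tau * eta) * d <= phi (tau * eta) / 2 * d.
  have -> : phi (tau * eta) / 2 * d = eta * (kappa * eps * d).
    by rewrite /eps; field; rewrite !gt_eqF.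
  exact: le_trans slope (ler_wpM2l (ltW eta0) pled).
rewrite ler_pM2r //; lra.
Qed.

Lemma argmin_tilt_unique u x0 x1 : dual_norm u < delta -> ball xbar gamma x0 ->
  argmin B (tilt f u) x0 -> argmin B (tilt f u) x1 -> x1 = x0.
Proof.
move=> ud x0g x0u x1u; apply: contrapT => /eqP; rewrite -subr_eq0 -normr_gt0.
move=> /[dup] e0 /argmin_tilt_stable[eps eps0 stable].
have [w wle we] := dual_norming _ _ (x1 - x0).
(* The first bound allows the use of [stable], the second keeps [u + c w] within the [delta]
   ball. *)
pose c := Num.min eps ((delta - dual_norm u) / 2).
have c0 : 0 < c by rewrite lt_min eps0 divr_gt0 // subr_gt0.
have ceps : c <= eps by rewrite ge_min lexx.
have cdelta : c <= (delta - dual_norm u) / 2 by rewrite ge_min lexx orbT.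
have [v vE] := dual_perturb _ _ u w c.
have vd : dual_norm v < delta.
  have : dual_norm v <= dual_norm u + c.
    apply: dual_norm_le => x x1'; rewrite vE; apply: le_trans (ler_normD _ _) _.
    rewrite normrM (gtr0_norm c0); apply: lerD; first exact: dual_norm_ub.
    by apply: ler_piMr; [exact: ltW|exact: le_trans (wle _) x1'].
  lra.
have [|y yv ylt] := stable u v x0 vd x0g x0u.
  move=> z; rewrite vE addrAC subrr add0r normrM (gtr0_norm c0).
  by apply: ler_pM => //; exact: ltW.
have [a fx1] := argmin_tilt_fin _ _ _ _ f_proper Bxbar xbar_dom x1u.
have [b fy] := argmin_tilt_fin _ _ _ _ f_proper Bxbar xbar_dom yv.
have [Bx1 /(_ y)] := x1u; have [By /(_ _ Bx1)] := yv.
rewrite /tilt fx1 fy -!EFinB !lee_fin !vE => vle /(_ By) ule.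
(* Adding the minimality of [x1] for [u] and of [y] for [v] cancels [f] and [u]. Then [|x1 - x0| <=
   w (x1 - x0) <= w (y - x0) <= |y - x0|], against the choice of [y]. *)
have : c * w x1 <= c * w y by lra.
rewrite ler_pM2l //.
have := wle (x0 - y); move=> /ler_normlP[]; move: we; rewrite !dualB; lra.
Qed.

End WeakWellPosed.

Lemma SWLWP_SLWP : SWLWP phi f xbar -> SLWP phi f xbar.
Proof.
move=> [r [gamma [delta [tau [kappa [[r0 g0 d0 t0 k0] [[_ xmin] weak]]]]]]].
set B := closed_ball_ _ _ _ in xmin weak.
have Bxbar : B xbar by rewrite /B /closed_ball_ /= subrr normr0 ltW.
(* Halving [gamma] puts the closed ball of radius [r'] inside the open ball where [weak] holds. *)
pose r' := Num.min (gamma / 2) r.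
have r'0 : 0 < r' by rewrite lt_min r0 divr_gt0.
have r'g : r' < gamma by rewrite gt_min ltr_pdivrMr // ltr_pMr // ltr1n.
have r'r : r' <= r by rewrite ge_min lexx orbT.
have xg : ball xbar gamma xbar by exact: ballxx.
have [eps eps0 stable] := argmin_tilt_stable _ _ _ _ _ r0 t0 k0 weak _ r'0.
have [z z0] := dual_zero _ X.
have xz u : (forall x, u x = 0) -> argmin B (tilt f u) xbar.
  by move=> u0; split=> // w Bw; rewrite /tilt !u0 !sube0 xmin.
exists (Num.min delta eps), r', kappa, tau; split.
  by split; rewrite // lt_min d0.
move=> u; rewrite lt_min => /andP[ud ue].
(* Stability from the zero functional, whose tilt is minimized at [xbar], gives a minimizer [xu]
   within [r'] of [xbar]. *)
have [|xu xuu xulr] := stable z u xbar ud xg (xz _ z0).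
  move=> x; rewrite z0 subr0; apply: le_trans (dual_norm_bound _ _ _ _) _.
  by apply: ler_wpM2r => //; exact: ltW.
have xug : ball xbar gamma xu.
  by rewrite -ball_normE /=; exact: lt_trans r'g.
have unique := argmin_tilt_unique _ _ _ _ _ r0 t0 k0 weak u _ _ ud.
exists xu; split.
- exact: ltW.
- by move=> u0; exact: (unique _ _ xg (xz _ u0) xuu).
move=> x; rewrite /closed_ball_ /= => xr'.
have xgx : ball xbar gamma x by rewrite -ball_normE /=; exact: le_lt_trans r'g.
have := weak _ _ xgx ud.
have -> : argmin B (tilt f u) = [set xu].
  by apply/seteqP; split=> [y yu|_ ->//]; exact: (unique _ _ xug xuu yu).
by rewrite dist_to1 -EFinM /= (inf_over_argmin _ _ _ xuu).
Qed.

End Tilt.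

Theorem theorem5p2 (R : realType) (phi : R -> R)
    (phi_adm : admissible phi)
    (phi_diff : differentiable_nneg phi)
    (phi_convex : strictly_convex_nneg phi)
    (phi_deriv0 : has_right_derivative0 phi 0)
    (X : completeNormedModType R) (f : X -> \bar R)
    (f_proper : proper_fun f)
    (f_lsc : lower_semicontinuous f)
    (xbar : X) (xbar_dom : dom f xbar) :
  SLWP phi f xbar <-> SWLWP phi f xbar.
Proof. by split; [exact: SLWP_SWLWP | exact: SWLWP_SLWP]. Qed.
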